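(* Let $N,J\ge1$, let $X=\{x_j\}_{j=1}^J$ be a set of sample points, let $Y$ be an equally spaced grid near $X$ with $2N-1$ points, and let $I_X:\mathbb{C}^{2N-1}\to\mathbb{C}^J$ be a linear operator that interpolates from functions on $Y$ to functions on $X$. Let $f\in\mathbb{C}^J$ and $\tau>0$. Let $\mu_1,\ldots,\mu_J$ be positive weights and choose $1<q<\infty$ such that, as operators on $\mathcal{H}$, $$\Lambda\beta^{-1}I_X^*\,\mu\,I_X\beta^{-1}\Lambda^*\le q\,I .$$ Let $$F=\Lambda\left(\frac1\beta I_X^*\Big(\frac{\mu f}{q}\Big)\right),\qquad \mathsf{U}(F,A)=F+A-\Lambda\left(\frac{1}{q\beta}I_X^*\Big(\mu\,I_X\Big(\frac1\beta\Lambda^*(A)\Big)\Big)\right).$$ Let $(W',A')=\mathfrak{B}_{\mathrm{us}}(W,A)$, for $W\in\mathbb{M}_{N,N}$ and $A\in\mathcal{H}$, be defined by $$W'=\mathfrak{S}_{s_{\tau,q}}\Big(q\,\mathsf{U}(F,A)+\mathcal{P}_{\mathcal{H}^\perp}(W)\Big),\qquad A'=\frac{1}{q-1}\Big(q\,\mathsf{U}(F,A)-\mathcal{P}_{\mathcal{H}}(W')\Big).$$ Let $A^{\circ}=\Lambda(a^{\circ})$ with $a^{\circ}\in\mathbb{C}^{2N-1}$. Then there exists $W^{\circ}$ such that $(W^{\circ},A^{\circ})$ is a fixed point of $\mathfrak{B}_{\mathrm{us}}$ if and only if $A^{\circ}=\Lambda(a^{\circ})$ is a stationary point of the objective functional $$\mathcal{R}_{\tau}(\Lambda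 a)+\sum_{j}\mu_j\,\big|(I_Xa-f)_j\big|^2 .$$ The objective functional is convex if $\Lambda\beta^{-1}I_X^*\,\mu\,I_X\beta^{-1}\Lambda^*\ge I$ (as operators on $\mathcal{H}$), and strictly convex if the inequality is strict.
   Context: $\mathbb{M}_{N,N}$ is the Euclidean space of complex $N\times N$ matrices with the Frobenius norm; $\sigma_j(A)$ denotes singular values. For $\tau>0$, $\mathcal{R}_{\tau}(A)=\sum_j\left(\tau^2-(\max(\tau-\sigma_j(A),0))^2\right)$. Functions on $X$ are identified with $\mathbb{C}^J$ and functions on the grid $Y$ with $\mathbb{C}^{2N-1}$. No particular interpolation operator $I_X$ is prescribed (as a matrix, an interpolation operator has, for instance, rows summing to one); $I_X^*$ is its adjoint for the standard inner products. $\mathcal{H}\subset\mathbb{M}_{N,N}$ is the subspace of Hankel matrices (constant along anti-diagonals), and $I$ is the identity on $\mathcal{H}$. $\Lambda:\mathbb{C}^{2N-1}\to\mathbb{M}_{N,N}$ is $(\Lambda a)_{j,k}=a_{j+k-1}$, $1\le j,k\le N$; its adjoint is $(\Lambda^*A)_l=\sum_{1\le j,k\le N,\ j+k-1=l}A_{j,k}$, and $\beta_l=\#\{(j,k):1\le j,k\le N,\ j+k-1=l\}$. Multiplication and division by the sequences $\mu$ and $\beta$ are pointwise (i.e. $\mu$, $\beta^{-1}$ in operator expressions stand for the corresponding diagonal operators). $\mathcal{P}_{\mathcal{H}}$, $\mathcal{P}_{\mathcal{H}^\perp}$ are the orthogonal projections onto $\mathcal{H}$ and its orthogonal complement. For a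 real-valued $g$ on $[0,\infty)$ with $g(0)=0$ and a singular value decomposition $A=U\,\mathrm{diag}(\{\sigma_j(A)\})V^*$, $\mathfrak{S}_g(A)=U\,\mathrm{diag}(\{g(\sigma_j(A))\})V^*$. Here $s_{\tau,q}(\sigma)=\max\left(\min(\sigma,\tau),\frac{\sigma}{q}\right)$. The objective is viewed as a functional on $\mathcal{H}$ through the bijection $a\mapsto\Lambda a$. Since $\mathcal{R}_\tau(A)+\|A\|^2$ is convex, it is a convex function plus a smooth quadratic; a stationary point is a point at which $0$ belongs to its subdifferential (convex subdifferential of the convex part plus gradient of the smooth part, over the reals). *)

(* Defs.v *)
From HB Require Import structures.
From mathcomp Require Export all_boot all_order all_algebra.
From mathcomp Require Export sesquilinear spectral.
From mathcomp Require Export complex.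
From mathcomp Require Export boolp classical_sets reals.
From mathcomp Require Import zify.

Set Implicit Arguments.
Unset Strict Implicit.
Unset Printing Implicit Defensive.

Import Order.TTheory GRing.Theory Num.Theory.
Local Open Scope ring_scope.
Local Open Scope complex_scope.
Local Open Scope sesquilinear_scope.
Local Open Scope classical_set_scope.

Section InnerProduct.
Variable R : realType.
Local Notation C := R[i].

Definition dot m n (A B : 'M[C]_(m, n)) : C := \tr (A *m B^t*).

Definition rdot m n (A B : 'M[C]_(m, n)) : R := complex.Re (dot A B).

Definition sqnorm m n (A : 'M[C]_(m, n)) : R := rdot A A.

Definition fnorm m n (A : 'M[C]_(m, n)) : R := Num.sqrt (sqnorm A).

(* Unconstrained (junk value 0) if A has no orthogonal projection on H; every
   subspace H of the finite-dimensional space of matrices provides a unique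
   one. *)
Definition oproj m n (H : set 'M[C]_(m, n)) (A : 'M[C]_(m, n)) : 'M[C]_(m, n) :=
  xget 0 [set P | H P /\ forall B, H B -> dot (A - P) B = 0].

Definition oproj_perp m n (H : set 'M[C]_(m, n)) : 'M[C]_(m, n) -> 'M[C]_(m, n) :=
  oproj [set A | forall B, H B -> dot A B = 0].

(* Loewner order on H.  The order of R[i] is such that 0 <= z means that z is
   real and nonnegative. *)
Definition op_le m n (H : set 'M[C]_(m, n)) (S T : 'M[C]_(m, n) -> 'M[C]_(m, n)) :=
  forall A, H A -> 0 <= dot (T A - S A) A.

Definition op_lt m n (H : set 'M[C]_(m, n)) (S T : 'M[C]_(m, n) -> 'M[C]_(m, n)) :=
  forall A, H A -> A != 0 -> 0 < dot (T A - S A) A.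

Definition pmul n (w : 'I_n -> R) (v : 'cV[C]_n) : 'cV[C]_n :=
  \col_i ((w i)%:C * v i 0).

End InnerProduct.

(* Real-valued functionals on a subspace H of complex matrices, regarded as a
   real vector space with inner product rdot (the library gives matrices over
   R[i] no structure of module over R). *)
Section Functionals.
Variables (R : realType) (m n : nat).
Local Notation C := R[i].
Implicit Types (H : set 'M[C]_(m, n)) (G c s : 'M[C]_(m, n) -> R).

Definition convex_on H G :=
  forall A B (t : R), H A -> H B -> 0 <= t <= 1 ->
    G (t%:C *: A + (1 - t)%:C *: B) <= t * G A + (1 - t) * G B.

Definition strictly_convex_on H G :=
  forall A B (t : R), H A -> H B -> A != B -> 0 < t < 1 ->
    G (t%:C *: A + (1 - t)%:C *: B) < t * G A + (1 - t) * G B.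

Definition is_subgradient H c (A Z : 'M[C]_(m, n)) :=
  H Z /\ forall B, H B -> c A + rdot Z (B - A) <= c B.

Definition is_gradient H s (A Z : 'M[C]_(m, n)) :=
  H Z /\ forall e : R, 0 < e -> exists2 d : R, 0 < d &
    forall B, H B -> fnorm B < d ->
      `|s (A + B) - s A - rdot Z B| <= e * fnorm B.

(* Stationarity of G, written as the sum of the convex function c and of the
   smooth function G - c: 0 is in the subdifferential of c at A plus the
   gradient of G - c at A. *)
Definition stationary H c G (A : 'M[C]_(m, n)) :=
  exists Z1 Z2, [/\ is_subgradient H c A Z1,
    is_gradient H (fun B => G B - c B) A Z2 & Z1 + Z2 = 0].

End Functionals.

Section SingularValues.
Variables (R : realType) (N : nat).
Local Notation C := R[i].

Definition diagR (s : 'rV[R]_N) : 'M[C]_N := diag_mx (map_mx (real_complex R) s).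

Definition is_svd (A : 'M[C]_N) (d : 'M[C]_N * 'rV[R]_N * 'M[C]_N) :=
  let: (U, s, V) := d in
  [/\ U \is unitarymx, V \is unitarymx, forall j, 0 <= s 0 j &
      A = U *m diagR s *m V^t*].

(* A singular value decomposition of A, with the singular values in no
   particular order: Rtau below, as well as Sg g A when g 0 = 0, do not depend
   on the decomposition selected. *)
Definition svd (A : 'M[C]_N) : 'M[C]_N * 'rV[R]_N * 'M[C]_N :=
  xget (0, 0, 0) [set d | is_svd A d].

Definition sv (A : 'M[C]_N) : 'rV[R]_N := (svd A).1.2.

Definition Sg (g : R -> R) (A : 'M[C]_N) : 'M[C]_N :=
  let: (U, s, V) := svd A in U *m diagR (map_mx g s) *m V^t*.

Definition Rtau (tau : R) (A : 'M[C]_N) : R :=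
  \sum_j (tau ^+ 2 - Num.max (tau - sv A 0 j) 0 ^+ 2).

Definition stq (tau q sigma : R) : R := Num.max (Num.min sigma tau) (sigma / q).

End SingularValues.

(* Indices are shifted to start at 0: (Lambda a)_(j, k) = a_(j + k). *)
Section Hankel.
Variables (R : realType) (N : nat).
Local Notation C := R[i].

Definition hankel : set 'M[C]_N :=
  [set A | forall j k j' k' : 'I_N, (j + k = j' + k')%N -> A j k = A j' k'].

Lemma antidiag_subproof (j k : 'I_N) : (j + k < 2 * N - 1)%N.
Proof. by have := ltn_ord j; have := ltn_ord k; lia. Qed.

Definition antidiag (j k : 'I_N) : 'I_(2 * N - 1) :=
  Ordinal (antidiag_subproof j k).

Definition Lambda (a : 'cV[C]_(2 * N - 1)) : 'M[C]_N :=
  \matrix_(j, k) a (antidiag j k) 0.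

Definition Lambda_adj (A : 'M[C]_N) : 'cV[C]_(2 * N - 1) :=
  \col_l \sum_(p : 'I_N * 'I_N | antidiag p.1 p.2 == l) A p.1 p.2.

Definition beta (l : 'I_(2 * N - 1)) : R :=
  #|[set p : 'I_N * 'I_N | antidiag p.1 p.2 == l]%SET|%:R.

(* The inverse of Lambda, as a map onto the Hankel matrices: see LambdaK and
   Lambda_invK below. *)
Definition Lambda_inv (A : 'M[C]_N) : 'cV[C]_(2 * N - 1) :=
  pmul (fun l => (beta l)^-1) (Lambda_adj A).

Lemma Lambda_hankel a : hankel (Lambda a).
Proof.
by move=> j k j' k' jk; rewrite !mxE; congr (a _ _); apply: val_inj.
Qed.

Lemma Lambda_adjE a (l : 'I_(2 * N - 1)) :
  Lambda_adj (Lambda a) l 0 = (beta l)%:C * a l 0.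
Proof.
rewrite mxE (eq_bigr (fun=> a l 0)); last by move=> p /eqP <-; rewrite mxE.
rewrite sumr_const rmorph_nat mulr_natl; congr (_ *+ _).
by apply: eq_card => p; rewrite inE.
Qed.

Lemma antidiag_ex (l : 'I_(2 * N - 1)) : {p | antidiag p.1 p.2 = l}.
Proof.
have lN := ltn_ord l.
have jN : (minn l N.-1 < N)%N by lia.
have kN : (l - minn l N.-1 < N)%N by lia.
by exists (Ordinal jN, Ordinal kN); apply: val_inj => /=; lia.
Qed.

Lemma beta_gt0 (l : 'I_(2 * N - 1)) : 0 < beta l.
Proof.
have [p pl] := antidiag_ex l.
by rewrite ltr0n card_gt0; apply/set0Pn; exists p; rewrite inE pl.
Qed.

Lemma LambdaK : cancel Lambda Lambda_inv.
Proof.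
move=> a; apply/colP => l; rewrite mxE Lambda_adjE mulrA -rmorphM /=.
by rewrite mulVf ?rmorph1 ?mul1r // gt_eqF ?beta_gt0.
Qed.

Lemma Lambda_surj (A : 'M[C]_N) : hankel A -> exists a, A = Lambda a.
Proof.
move=> hA; exists (\col_l let p := sval (antidiag_ex l) in A p.1 p.2).
apply/matrixP => j k; rewrite !mxE.
by case: antidiag_ex => p /= e; apply: hA; have /(congr1 val) := e.
Qed.

Lemma Lambda_invK (A : 'M[C]_N) : hankel A -> Lambda (Lambda_inv A) = A.
Proof. by move=> /Lambda_surj[a ->]; rewrite LambdaK. Qed.

End Hankel.
Arguments hankel {R N}.

Section Algorithm.
Variables (R : realType) (N J : nat).
Local Notation C := R[i].
Variables (IX : 'M[C]_(J, 2 * N - 1)) (mu : 'I_J -> R) (f : 'cV[C]_J) (tau q : R).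

(* Lambda beta^-1 IX^* mu IX beta^-1 Lambda^* *)
Definition samplop (A : 'M[C]_N) : 'M[C]_N :=
  Lambda (pmul (fun l => (beta R l)^-1) (IX^t* *m pmul mu
    (IX *m pmul (fun l => (beta R l)^-1) (Lambda_adj A)))).

Definition Fdata : 'M[C]_N :=
  Lambda (pmul (fun l => (beta R l)^-1) (IX^t* *m (q^-1%:C *: pmul mu f))).

Definition Uop (F A : 'M[C]_N) : 'M[C]_N :=
  F + A - Lambda (pmul (fun l => (q * beta R l)^-1) (IX^t* *m pmul mu
    (IX *m pmul (fun l => (beta R l)^-1) (Lambda_adj A)))).

Definition Bus (WA : 'M[C]_N * 'M[C]_N) : 'M[C]_N * 'M[C]_N :=
  let: (W, A) := WA in
  let W' := Sg (stq tau q) (q%:C *: Uop Fdata A + oproj_perp hankel W) in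
  let A' := (q - 1)^-1%:C *: (q%:C *: Uop Fdata A - oproj hankel W') in
  (W', A').

Definition fidelity (a : 'cV[C]_(2 * N - 1)) : R :=
  \sum_j mu j * complex.Re `|(IX *m a - f) j 0| ^+ 2.

Definition objective (a : 'cV[C]_(2 * N - 1)) : R :=
  Rtau tau (Lambda a) + fidelity a.

(* The objective as a functional of the Hankel matrix A = Lambda a *)
Definition objectiveH (A : 'M[C]_N) : R := objective (Lambda_inv A).

Definition convex_part (A : 'M[C]_N) : R := Rtau tau A + sqnorm A.

(* the smooth part of the objective is a quadratic function *)
Lemma objectiveH_sub A : hankel A ->
  objectiveH A - convex_part A = fidelity (Lambda_inv A) - sqnorm A.
Proof.
by move=> hA; rewrite /objectiveH /objective Lambda_invK //
  /convex_part opprD addrACA subrr add0r.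
Qed.

End Algorithm.

(* Main.v *)
Require Import Defs.
From mathcomp Require Import ring lra.

(** Write c for the convex part R_tau + |.|^2, g for its scalar counterpart
    (penalty), K for the sampling operator samplop, b for the back-projected data
    Lambda (beta^-1 IX^* (mu f)) (backproj), and D(A) = b + A - K A (descent).

    - Fixed points.  Since q U(F, A) = D(A) + (q - 1) A, the pair (W, A) is fixed
      if and only if P_H W = D(A) and W = Sg (W + (q - 1) A) (Bus_fixedP).
    - The threshold is a proximal map.  For scalars, w = s_{tau,q} (w + (q - 1) a)
      says that 2 w is a subgradient of g at a (stq_subgradient).  The same holds
      for matrices (Sg_fixedP): if A = U diag(a) V^* and W = U diag(w) V^* with 2 w
      a slope of g at a entrywise, then 2 W is a subgradient of c at A
      (svd_subgradient).  The reason is that the inner product of W with another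
      matrix P diag(s) Q^* is at most the sum of the S_kj w_j s_k for some doubly
      stochastic matrix S, so that the scalar subgradient inequalities can be
      averaged against S (rdot_svd_le).  This also proves that c is convex and
      does not depend on the chosen decomposition.  Monotonicity of subgradients
      makes the solution of the proximal equation unique.
    - Stationary points.  On Hankel matrices the objective minus c is quadratic,
      with gradient - 2 D(A) (quadratic_expansion), so A is stationary if and only
      if 2 D(A) is a subgradient at A of c restricted to the Hankel matrices
      (stationaryP).  By the Hahn-Banach theorem, applied to the real-linear
      functional that 2 D(A) defines on this subspace, such subgradients are
      exactly the projections of subgradients 2 W of c on the whole space
      (subgradient_hankelP).  So A is stationary if and only if some W satisfies
      both conditions for a fixed point.
    - Convexity.  The quadratic part has second order term <(K - I) B, B>, so the
      convexity gap of the objective on the segment from A to B is at least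
      t (1 - t) <(K - I) (A - B), A - B> (objective_convexity_gap). *)

Set Implicit Arguments.
Unset Strict Implicit.
Unset Printing Implicit Defensive.

Import Order.TTheory GRing.Theory Num.Theory.
Local Open Scope ring_scope.
Local Open Scope complex_scope.
Local Open Scope sesquilinear_scope.

(** * Inner products of complex matrices *)

Section InnerProductTheory.
Variable R : realType.
Local Notation C := R[i].
Variables m n : nat.
Implicit Types A B D : 'M[C]_(m, n).

Lemma dotE A B : dot A B = \sum_i \sum_j A i j * (B i j)^*.
Proof.
rewrite /dot /mxtrace; apply: eq_bigr => i _; rewrite mxE.
by apply: eq_bigr => j _; rewrite !mxE.
Qed.

Lemma dotC A B : dot B A = (dot A B)^*.
Proof.
rewrite !dotE rmorph_sum; apply: eq_bigr => i _; rewrite rmorph_sum /=.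
by apply: eq_bigr => j _; rewrite rmorphM /= conjcK mulrC.
Qed.

Lemma dotBl A B D : dot (A - B) D = dot A D - dot B D.
Proof. by rewrite /dot mulmxBl raddfB. Qed.

Lemma ReMconj (a b : C) :
  complex.Re (a * b^*) = complex.Re a * complex.Re b + complex.Im a * complex.Im b.
Proof. by case: a b => [a1 a2] [b1 b2] /=; rewrite mulrN opprK. Qed.

Lemma rdotE A B : rdot A B = \sum_i \sum_j
  (complex.Re (A i j) * complex.Re (B i j) + complex.Im (A i j) * complex.Im (B i j)).
Proof.
rewrite /rdot dotE raddf_sum /=; apply: eq_bigr => i _; rewrite raddf_sum /=.
by apply: eq_bigr => j _; rewrite ReMconj.
Qed.

Lemma rdotC A B : rdot A B = rdot B A.
Proof.
by rewrite !rdotE; do 2!apply: eq_bigr => ? _; rewrite mulrC [X in _ + X]mulrC.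
Qed.

Lemma rdotDl A B D : rdot (A + B) D = rdot A D + rdot B D.
Proof. by rewrite /rdot /dot mulmxDl mxtraceD raddfD. Qed.

Lemma rdotZl (t : R) A B : rdot (t%:C *: A) B = t * rdot A B.
Proof.
by rewrite /rdot /dot -scalemxAl mxtraceZ; case: (\tr _) => a b /=; rewrite mul0r subr0.
Qed.

Lemma rdotNl A B : rdot (- A) B = - rdot A B.
Proof. by rewrite /rdot /dot mulNmx !raddfN. Qed.

Lemma rdotDr A B D : rdot A (B + D) = rdot A B + rdot A D.
Proof. by rewrite rdotC rdotDl !(rdotC A). Qed.

Lemma rdotZr (t : R) A B : rdot A (t%:C *: B) = t * rdot A B.
Proof. by rewrite rdotC rdotZl rdotC. Qed.

Lemma rdotNr A B : rdot A (- B) = - rdot A B.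
Proof. by rewrite rdotC rdotNl rdotC. Qed.

Lemma rdot0r A : rdot A 0 = 0.
Proof. by rewrite -(subrr 0) rdotDr rdotNr subrr. Qed.

Definition rdotl := (rdotDl, rdotNl, rdotZl).
Definition rdotr := (rdotDr, rdotNr, rdotZr).

Lemma sqnormE A : sqnorm A = \sum_i \sum_j
  (complex.Re (A i j) ^+ 2 + complex.Im (A i j) ^+ 2).
Proof. exact: rdotE. Qed.

Lemma sqnorm_ge0 A : 0 <= sqnorm A.
Proof. by rewrite sqnormE; do 2!apply: sumr_ge0 => ? _; rewrite addr_ge0 ?sqr_ge0. Qed.

Lemma sqnorm_eq0 A : sqnorm A = 0 -> A = 0.
Proof.
rewrite sqnormE => /eqP; rewrite psumr_eq0; last first.
  by move=> i _; apply: sumr_ge0 => ? _; rewrite addr_ge0 ?sqr_ge0.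
move=> /allP A0; apply/matrixP => i j; rewrite mxE.
have /implyP/(_ isT) := A0 i (mem_index_enum i).
rewrite psumr_eq0; last by move=> ? _; rewrite addr_ge0 ?sqr_ge0.
move=> /allP/(_ j (mem_index_enum j))/implyP/(_ isT).
rewrite paddr_eq0 ?sqr_ge0 // !sqrf_eq0 => /andP[/eqP re0 /eqP im0].
by apply/eqP; rewrite eq_complex re0 im0 !eqxx.
Qed.

Lemma fnorm_sqr A : fnorm A ^+ 2 = sqnorm A.
Proof. by rewrite sqr_sqrtr ?sqnorm_ge0. Qed.

Lemma sqnormZ (t : R) A : sqnorm (t%:C *: A) = t ^+ 2 * sqnorm A.
Proof. by rewrite /sqnorm rdotl rdotr mulrA. Qed.

Lemma fnormZ (t : R) A : 0 <= t -> fnorm (t%:C *: A) = t * fnorm A.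
Proof. by move=> t0; rewrite /fnorm sqnormZ sqrtrM ?sqr_ge0 // sqrtr_sqr ger0_norm. Qed.

Lemma segment_left (t : R) A B :
  A = t%:C *: A + (1 - t)%:C *: B + (1 - t)%:C *: (A - B).
Proof.
rewrite -addrA -scalerDr (addrC B) subrK -scalerDl.
by rewrite -rmorphD /= (addrC t) subrK scale1r.
Qed.

Lemma segment_right (t : R) A B :
  B = t%:C *: A + (1 - t)%:C *: B + (- t)%:C *: (A - B).
Proof.
rewrite rmorphN scaleNr scalerBr opprB (addrC (t%:C *: B)) addrACA subrr add0r -scalerDl.
by rewrite -rmorphD /= subrK scale1r.
Qed.

End InnerProductTheory.

(** * Singular value decompositions *)

Section SVD.
Variable R : realType.
Local Notation C := R[i].

Lemma trmxCM m n p (A : 'M[C]_(m, n)) (B : 'M[C]_(n, p)) :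
  (A *m B)^t* = B^t* *m A^t*.
Proof. by rewrite trmx_mul map_mxM. Qed.

Lemma mulmx_trmxCE m n p (A : 'M[C]_(m, n)) (B : 'M[C]_(p, n)) i j :
  (A *m B^t*) i j = \sum_l A i l * (B j l)^*.
Proof. by rewrite mxE; apply: eq_bigr => l _; rewrite !mxE. Qed.

Lemma sqnorm_dot m n (A : 'M[C]_(m, n)) : dot A A = (sqnorm A)%:C.
Proof.
have e := dotC A A; rewrite /sqnorm /rdot; move: e; case: (dot A A) => a b [/eqP].
by rewrite -subr_eq0 opprK -mulr2n mulrn_eq0 /= => /eqP ->.
Qed.

Lemma conjR (x : R) : Num.conj x%:C = x%:C.
Proof. exact: conjc_real. Qed.

(** The rows of M indexed by S are orthonormal and the others are zero; the zero
    rows are replaced one at a time by unit vectors orthogonal to all rows. *)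
Lemma unitary_completion N (S : {set 'I_N}) (M : 'M[C]_N) :
  (forall i j, (M *m M^t*) i j = ((i == j) && (i \in S))%:R) ->
  exists2 U : 'M[C]_N, U \is unitarymx & forall i, i \in S -> row i U = row i M.
Proof.
have [k] := ubnP #|~: S|; elim: k S M => // k IH S M leSk MM.
have [S0|[i0 i0S]] := set_0Vmem (~: S).
  exists M => //; apply/unitarymxP/matrixP => i j; rewrite MM mxE.
  have -> : i \in S by move/setP/(_ i): S0; rewrite !inE => /negbFE.
  by rewrite andbT.
have i0S' : i0 \notin S by rewrite inE in i0S.
(* M M^* has a zero row, so M^* is singular: some nonzero v is orthogonal to
   every row of M *)
have [v v0 vM] : exists2 v : 'rV[C]_N, v != 0 & v *m M^t* = 0.
  apply/det0P; suff : \det (M *m M^t*) == 0.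
    by rewrite det_mulmx det_map_mx det_tr mulf_eq0 conjC_eq0 orbb.
  apply/det0P; exists (delta_mx 0 i0).
    by apply/eqP => /matrixP/(_ 0 i0)/eqP; rewrite !mxE !eqxx oner_eq0.
  rewrite -rowE; apply/rowP => j; rewrite mxE MM mxE (negbTE i0S').
  by rewrite andbF.
have nv0 : fnorm v != 0.
  apply: contra v0 => /eqP nv; apply/eqP/sqnorm_eq0.
  by rewrite -fnorm_sqr nv expr0n.
pose u := (fnorm v)^-1%:C *: v.
have uu : (u *m u^t*) 0 0 = 1.
  have -> : (u *m u^t*) 0 0 = dot u u by rewrite /dot trace_mx11.
  by rewrite sqnorm_dot sqnormZ -fnorm_sqr -exprMn mulVf ?expr1n.
have uM j : (u *m M^t*) 0 j = 0 by rewrite -scalemxAl vM scaler0 mxE.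
have Mu j : (M *m u^t*) j 0 = 0.
  have -> : M *m u^t* = (u *m M^t*)^t* by rewrite trmxCM trmxCK.
  by rewrite 2!mxE uM rmorph0.
pose M' : 'M[C]_N := \matrix_(i, l) if i == i0 then u 0 l else M i l.
have M'E i j : (M' *m M'^t*) i j =
   if i == i0 then if j == i0 then (u *m u^t*) 0 0 else (u *m M^t*) 0 j
   else if j == i0 then (M *m u^t*) i 0 else (M *m M^t*) i j.
  rewrite !mulmx_trmxCE.
  by do 2![case: ifP => ?]; apply: eq_bigr => l _; rewrite !mxE;
    do ?[case: ifP => // ?]; congruence.
have [||U Uunit UM] := IH (i0 |: S) M'.
- move: leSk; rewrite !ltnS; apply: leq_trans; apply: proper_card.
  rewrite properE finset.setCS finset.subsetU1 /=; apply/subsetPn; exists i0 => //.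
  by rewrite !inE eqxx.
- move=> i j; rewrite M'E uu uM Mu MM !inE.
  have [->|ii0] := eqVneq i i0; first by rewrite eq_sym andbT; case: ifP.
  by have [->|_] := eqVneq j i0; rewrite ?(negbTE ii0).
- exists U => // i iS; rewrite UM ?inE ?iS ?orbT //.
  apply/rowP => l; rewrite !mxE; case: eqP => // ii0.
  by rewrite ii0 (negbTE i0S') in iS.
Qed.

(** The rows of P A, where P diagonalizes A A^*, are mutually orthogonal;
    their norms are the singular values, and the normalized nonzero rows extend
    to a unitary matrix, the right factor. *)
Theorem svd_exists N (A : 'M[C]_N) : exists d, is_svd A d.
Proof.
have hA : A *m A^t* \is normalmx.
  by apply/normalmxP; rewrite !trmxCM trmxCK.
have := @orthomx_spectralP _ _ (A *m A^t*); move=> /elimT/(_ hA).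
have := spectral_unitarymx (A *m A^t*).
move: (spectralmx _) (spectral_diag _) => P d Pu.
rewrite invmx_unitary // => AA.
have /unitarymxP PP := Pu.
pose B := P *m A.
have BBm : B *m B^t* = diag_mx d.
  by rewrite /B trmxCM mulmxA -(mulmxA P) AA !mulmxA PP mul1mx -mulmxA PP mulmx1.
pose s : 'rV[R]_N := \row_i fnorm (row i B).
have dE i : d 0 i = (s 0 i ^+ 2)%:C.
  have := congr1 (fun X : 'M_N => X i i) BBm; rewrite !mxE eqxx mulr1n => <-.
  rewrite fnorm_sqr -sqnorm_dot dotE big_ord_recl big_ord0 addr0.
  by apply: eq_bigr => l _; rewrite !mxE.
have BB i j : (B *m B^t*) i j = (s 0 i ^+ 2)%:C *+ (i == j).
  by rewrite BBm [LHS]mxE dE.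
pose S := [set i | s 0 i != 0].
pose M : 'M[C]_N := \matrix_(i, l) ((s 0 i)^-1%:C * B i l).
have [i j|U Uu UM] := @unitary_completion _ S M.
  transitivity ((s 0 i)^-1%:C * (s 0 j)^-1%:C * (B *m B^t*) i j).
    rewrite !mulmx_trmxCE mulr_sumr; apply: eq_bigr => l _.
    by rewrite [M i l]mxE [M j l]mxE rmorphM /= conjR; ring.
  rewrite BB inE; have [<-|_] := eqVneq i j; last by rewrite mulr0n mulr0.
  have [s0|s0] := eqVneq (s 0 i) 0; first by rewrite s0 expr0n /= mulr0.
  rewrite mulr1n -!rmorphM /= -expr2 -exprMn mulVf // expr1n //.
exists (P^t*, s, U^t*); split; rewrite ?trmxC_unitary //.
  by move=> j; rewrite mxE sqrtr_ge0.
rewrite trmxCK -mulmxA; have -> : diagR s *m U = B; last first.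
  by rewrite /B mulmxA (mulmx1C PP) mul1mx.
apply/row_matrixP => i; rewrite row_mul row_diag_mx -scalemxAl -rowE !mxE.
have [s0|s0] := eqVneq (s 0 i) 0.
  rewrite -[fnorm _]/(fnorm (row i B)).
  have e : s 0 i = fnorm (row i B) by rewrite mxE.
  rewrite -e s0 scale0r; apply/esym/sqnorm_eq0.
  by rewrite -fnorm_sqr -e s0 expr0n.
rewrite UM ?inE //; apply/rowP => l; rewrite !mxE.
have e : s 0 i = fnorm (row i B) by rewrite mxE.
by rewrite -e mulrA -rmorphM /= mulfV // mul1r.
Qed.

Lemma svdP N (A : 'M[C]_N) : is_svd A (svd A).
Proof.
have [d svd_d] := svd_exists A.
by rewrite /svd; case: xgetP => [? _ //|/(_ d)].
Qed.

End SVD.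

(** * Subgradients of separable functions of the singular values *)

Section SingularValueSubgradient.
Variables (R : realType) (N : nat).
Local Notation C := R[i].
Implicit Types (U V P Q A B W : 'M[C]_N) (w a s : 'rV[R]_N).

Definition abssq (z : C) : R := complex.Re z ^+ 2 + complex.Im z ^+ 2.

Lemma abssq_unitary U : U \is unitarymx ->
  (forall k, \sum_j abssq (U k j) = 1) /\ (forall j, \sum_k abssq (U k j) = 1).
Proof.
have rows (X : 'M[C]_N) : X \is unitarymx -> forall k, \sum_j abssq (X k j) = 1.
  move=> /unitarymxP XX k.
  have := congr1 (fun M : 'M_N => complex.Re (M k k)) XX.
  rewrite mulmx_trmxCE mxE eqxx raddf_sum /= => <-.
  by apply: eq_bigr => j _; rewrite ReMconj.
move=> Uu; split=> [k|j]; first exact: rows.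
rewrite -(rows (U^t*) _ j) ?trmxC_unitary //; apply: eq_bigr => k _.
by rewrite !mxE /abssq; case: (U k j) => a b /=; rewrite sqrrN.
Qed.

Lemma rdot_svd U V P Q w s :
  rdot (U *m diagR w *m V^t*) (P *m diagR s *m Q^t*) =
  \sum_k \sum_j w 0 j * s 0 k *
    complex.Re ((P^t* *m U) k j * (V^t* *m Q) j k).
Proof.
rewrite /rdot /dot !trmxCM trmxCK.
have -> : (diagR s)^t* = diagR s.
  apply/matrixP => i j; rewrite !mxE rmorphMn /= conjR eq_sym.
  by case: eqP => [->|].
rewrite !mulmxA mxtrace_mulC !mulmxA -(mulmxA _ (V^t*) Q).
rewrite /mxtrace raddf_sum; apply: eq_bigr => k _.
rewrite mul_mx_diag mxE -mulmxA [X in X * _]mxE mulr_suml raddf_sum /=.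
apply: eq_bigr => j _; rewrite mulmxA mul_mx_diag mxE.
move: ((P^t* *m U) k j) ((V^t* *m Q) j k) => [a b] [c d] /=.
have -> : map_mx (real_complex R) w 0 j = (w 0 j)%:C by rewrite mxE.
have -> : map_mx (real_complex R) s 0 k = (s 0 k)%:C by rewrite mxE.
by rewrite /=; ring.
Qed.

(** Expanding the trace, the pairs of singular values are weighted by products
    of entries of two unitary matrices; by 2|ab| <= |a|^2 + |b|^2 these are
    dominated by a doubly stochastic matrix. *)
Lemma rdot_svd_le U V P Q w s :
  U \is unitarymx -> V \is unitarymx -> P \is unitarymx -> Q \is unitarymx ->
  (forall j, 0 <= w 0 j) -> (forall k, 0 <= s 0 k) ->
  exists S : 'I_N -> 'I_N -> R,
  [/\ forall k j, 0 <= S k j, forall k, \sum_j S k j = 1,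
      forall j, \sum_k S k j = 1 &
      rdot (U *m diagR w *m V^t*) (P *m diagR s *m Q^t*) <=
      \sum_k \sum_j w 0 j * s 0 k * S k j].
Proof.
move=> Uu Vu Pu Qu w0 s0.
have Xu : P^t* *m U \is unitarymx.
  by apply: mul_unitarymx Uu; rewrite trmxC_unitary Pu.
have Yu : V^t* *m Q \is unitarymx.
  by apply: mul_unitarymx Qu; rewrite trmxC_unitary Vu.
have [Xr Xc] := abssq_unitary Xu; have [Yr Yc] := abssq_unitary Yu.
exists (fun k j => (abssq ((P^t* *m U) k j) + abssq ((V^t* *m Q) j k)) / 2).
split=> [k j|k|j|].
- by rewrite divr_ge0 // !addr_ge0 ?sqr_ge0.
- by rewrite -mulr_suml big_split /= Xr Yc; lra.
- by rewrite -mulr_suml big_split /= Xc Yr; lra.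
rewrite rdot_svd; apply: ler_sum => k _; apply: ler_sum => j _.
apply: ler_wpM2l; first by rewrite mulr_ge0.
rewrite /abssq; move: (_ k j) (_ j k) => [a b] [c d] /=.
have := sqr_ge0 (a - c); have := sqr_ge0 (b + d); nra.
Qed.

Lemma rdot_svd_same U V w s : U \is unitarymx -> V \is unitarymx ->
  rdot (U *m diagR w *m V^t*) (U *m diagR s *m V^t*) = \sum_j w 0 j * s 0 j.
Proof.
move=> /unitarymxP/mulmx1C UU /unitarymxP/mulmx1C VV.
rewrite rdot_svd UU VV; apply: eq_bigr => k _.
rewrite (bigD1 k) //= big1 => [|j jk]; last first.
  by rewrite !mxE eq_sym (negbTE jk) /= mul0r subr0 !mulr0.
by rewrite !mxE eqxx /= mulr1 mulr0 subr0 mulr1 addr0.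
Qed.

(** Averaging the scalar inequalities at the pairs (a_j, s_k) against the doubly
    stochastic matrix of rdot_svd_le gives the inequality between matrices. *)
Lemma svd_subgradient (g : R -> R) U V P Q w a s :
  U \is unitarymx -> V \is unitarymx -> P \is unitarymx -> Q \is unitarymx ->
  (forall j, 0 <= w 0 j) -> (forall k, 0 <= s 0 k) ->
  (forall j x, 0 <= x -> g (a 0 j) + w 0 j * (x - a 0 j) <= g x) ->
  \sum_j g (a 0 j) + rdot (U *m diagR w *m V^t*)
     (P *m diagR s *m Q^t* - U *m diagR a *m V^t*) <= \sum_k g (s 0 k).
Proof.
move=> Uu Vu Pu Qu w0 s0 gw.
have [S [S0 Sr Sc le]] := rdot_svd_le Uu Vu Pu Qu w0 s0.
rewrite rdotDr rdotNr rdot_svd_same //.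
have -> : \sum_k g (s 0 k) = \sum_k \sum_j g (s 0 k) * S k j.
  by apply: eq_bigr => k _; rewrite -mulr_sumr Sr mulr1.
have sum_rows (h : 'I_N -> R) : \sum_j h j = \sum_k \sum_j h j * S k j.
  rewrite exchange_big; apply: eq_bigr => j _.
  by rewrite -mulr_sumr Sc mulr1.
rewrite (sum_rows (fun j => g (a 0 j))) (sum_rows (fun j => w 0 j * a 0 j)).
apply: (le_trans (y := \sum_k \sum_j g (a 0 j) * S k j +
  (\sum_k \sum_j w 0 j * s 0 k * S k j - \sum_k \sum_j w 0 j * a 0 j * S k j))).
  by rewrite lerD2l lerD2r.
rewrite -sumrB -big_split; apply: ler_sum => k _ /=.
rewrite -sumrB -big_split; apply: ler_sum => j _ /=.
by have := ler_wpM2r (S0 k j) (gw j _ (s0 k)); nra.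
Qed.

End SingularValueSubgradient.

(** * The convex part of the objective and its proximal map *)

Section ConvexPart.
Variables (R : realType) (N : nat) (tau : R).
Local Notation C := R[i].
Implicit Types (A B W Y Z : 'M[C]_N).

Local Notation subgradient := (is_subgradient [set: 'M[C]_N]%classic (convex_part tau)).

Definition penalty (x : R) : R := tau ^+ 2 - Num.max (tau - x) 0 ^+ 2 + x ^+ 2.

(** On [0, +oo) the penalty is 2 tau x up to tau and tau^2 + x^2 beyond, so that
    Num.max tau a is half of a slope at a. *)
Lemma penalty_subgradient a x : 0 <= a -> 0 <= x ->
  penalty a + 2 * Num.max tau a * (x - a) <= penalty x.
Proof.
rewrite /penalty => a0 x0.
have := sqr_ge0 (x - a).
by case: (lerP tau a); case: (lerP (tau - a) 0); case: (lerP (tau - x) 0); nra.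
Qed.

(** The threshold splits s into w + (q - 1) a with w half of a slope at a:
    either s <= tau, and then a = 0, w = s and every value in [0, tau] is half of
    a slope at 0; or w = Num.max tau a. *)
Lemma stq_subgradient q s x : 1 < q -> 0 <= s -> 0 <= x ->
  let a := (q - 1)^-1 * (s - stq tau q s) in
  penalty a + 2 * stq tau q s * (x - a) <= penalty x.
Proof.
move=> q1 s0 x0 /=; set w := stq _ _ _; set a := _ * _.
have q0 : 0 < q by lra.
have aE : (s <= tau /\ w = s /\ a = 0) \/ (0 <= a /\ w = Num.max tau a).
  rewrite /a /w /stq; case: (lerP s tau) => st.
    left; have -> : Num.max s (s / q) = s.
      by apply/max_idPl; rewrite ler_pdivrMr // ler_peMr // ltW.
    by rewrite subrr mulr0.
  right; have q10 : 0 < q - 1 by rewrite subr_gt0.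
  case: (lerP (s / q) tau) => sq.
    rewrite mulr_ge0 ?invr_ge0 ?subr_ge0 ?ltW //; split=> //; apply/esym/max_idPl.
    by rewrite ler_pdivrMl //; move: sq; rewrite ler_pdivrMr //; lra.
  have -> : (q - 1)^-1 * (s - s / q) = s / q by field; rewrite !gt_eqF.
  by rewrite divr_ge0 ?(ltW q0) //; split=> //; apply/esym/max_idPr/ltW.
case: aE => [[st [ws ->]]|[a0 ->]]; last exact: penalty_subgradient.
rewrite ws /penalty subr0.
by case: (lerP tau 0); case: (lerP (tau - x) 0); nra.
Qed.

Lemma stq_ge0 q s : 1 < q -> 0 <= s -> 0 <= stq tau q s.
Proof.
by move=> q1 s0; rewrite le_max divr_ge0 ?orbT //; lra.
Qed.

(** The sum does not depend on the decomposition: each inequality between two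
    decompositions of A is the subgradient inequality at one of them, evaluated
    at A itself. *)
Lemma convex_partE A (U V : 'M[C]_N) (s : 'rV[R]_N) : is_svd A (U, s, V) ->
  convex_part tau A = \sum_j penalty (s 0 j).
Proof.
move=> svdA.
have le U1 s1 V1 U2 s2 V2 : is_svd A (U1, s1, V1) -> is_svd A (U2, s2, V2) ->
    \sum_j penalty (s1 0 j) <= \sum_j penalty (s2 0 j).
  move=> [U1u V1u s1_ge0 e1] [U2u V2u s2_ge0 e2].
  pose w := \row_j (2 * Num.max tau (s1 0 j)).
  have := @svd_subgradient _ _ penalty U1 V1 U2 V2 w s1 s2 U1u V1u U2u V2u.
  rewrite -e1 -e2 subrr rdot0r addr0; apply=> // [j|j x x0]; rewrite mxE.
    by rewrite mulr_ge0 // le_max s1_ge0 orbT.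
  exact: penalty_subgradient.
rewrite /convex_part /Rtau /sv; have := svdP A.
case: (svd A) => [[U1 s1] V1] svdA1 /=.
have -> : sqnorm A = \sum_j s1 0 j ^+ 2.
  by case: svdA1 => U1u V1u _ ->; rewrite /sqnorm rdot_svd_same.
rewrite -big_split; apply/eqP; rewrite eq_le.
by rewrite (le _ _ _ _ _ _ svdA1 svdA) (le _ _ _ _ _ _ svdA svdA1).
Qed.

Lemma convex_part_subgradient (U V : 'M[C]_N) (w a : 'rV[R]_N) :
  U \is unitarymx -> V \is unitarymx -> (forall j, 0 <= w 0 j) ->
  (forall j, 0 <= a 0 j) ->
  (forall j x, 0 <= x -> penalty (a 0 j) + 2 * w 0 j * (x - a 0 j) <= penalty x) ->
  subgradient (U *m diagR a *m V^t*) (2%:C *: (U *m diagR w *m V^t*)).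
Proof.
move=> Uu Vu w0 a0 wa; split=> // B _.
have [[[P s] Q] svdB] := svd_exists B.
rewrite (convex_partE svdB) (convex_partE (U := U) (V := V) (s := a)) //.
case: svdB => Pu Qu s0 ->.
have e : 2%:C *: (U *m diagR w *m V^t*) = U *m diagR (2 *: w) *m V^t*.
  have -> : diagR (2 *: w) = 2%:C *: diagR w.
    by apply/matrixP => i j; rewrite !mxE rmorphM /= mulrnAr.
  by rewrite -scalemxAr -scalemxAl.
rewrite e; apply: svd_subgradient => // j; rewrite mxE; last exact: wa.
by rewrite mulr_ge0.
Qed.

(** By svd_subgradient it is enough to choose a slope at each singular value. *)
Lemma convex_part_subdifferentiable A : exists Z, subgradient A Z.
Proof.
have [[[U s] V] [Uu Vu s0 ->]] := svd_exists A.
exists (2%:C *: (U *m diagR (\row_j Num.max tau (s 0 j)) *m V^t*)).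
apply: convex_part_subgradient => // j => [|x x0]; rewrite mxE.
  by rewrite le_max s0 orbT.
exact: penalty_subgradient.
Qed.

(** A function with a subgradient at every point lies above the affine function
    that the subgradient at an intermediate point defines. *)
Lemma convex_part_convex : convex_on [set: 'M[C]_N]%classic (convex_part tau).
Proof.
move=> A B t _ _ /andP[t0 t1]; set D := _ + _.
have [Z [_ sub]] := convex_part_subdifferentiable D.
have := sub A I; have := sub B I.
have -> : A - D = (1 - t)%:C *: (A - B).
  by rewrite [in LHS](segment_left t A B) -/D addrAC subrr add0r.
have -> : B - D = (- t)%:C *: (A - B).
  by rewrite [in LHS](segment_right t A B) -/D addrAC subrr add0r.
rewrite !rdotZr; move: (rdot _ _) => x; nra.
Qed.

Lemma Sg_subgradient q Y : 1 < q ->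
  subgradient ((q - 1)^-1%:C *: (Y - Sg (stq tau q) Y)) (2%:C *: Sg (stq tau q) Y).
Proof.
move=> q1; have := svdP Y; rewrite /Sg; case: (svd Y) => [[U s] V] [Uu Vu s0 YE].
have -> : (q - 1)^-1%:C *: (Y - U *m diagR (map_mx (stq tau q) s) *m V^t*) =
  U *m diagR (\row_j ((q - 1)^-1 * (s 0 j - stq tau q (s 0 j)))) *m V^t*.
  rewrite {1}YE -mulmxBl -mulmxBr scalemxAl scalemxAr.
  congr (_ *m _ *m _); apply/matrixP => i j.
  by rewrite !mxE -mulrnBl mulrnAr -rmorphB -rmorphM.
apply: convex_part_subgradient => // j.
- by rewrite mxE stq_ge0.
- rewrite mxE mulr_ge0 ?invr_ge0 ?subr_ge0 ?(ltW q1) // ge_max ge_min lexx /=.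
  by rewrite ler_pdivrMr ?ler_peMr //; lra.
- by move=> x x0; rewrite !mxE; apply: stq_subgradient.
Qed.

Lemma subgradient_monotone A B Z Y : subgradient A Z -> subgradient B Y ->
  0 <= rdot (Z - Y) (A - B).
Proof.
move=> [_ /(_ B I) hA] [_ /(_ A I)]; move: hA.
by rewrite !rdotl !rdotr; lra.
Qed.

(** Sg is a proximal map: W = Sg Y is half of a subgradient at
    (Y - W) / (q - 1), and no other W is, because subgradients are monotone. *)
Lemma Sg_fixedP q A W : 1 < q ->
  W = Sg (stq tau q) (W + (q - 1)%:C *: A) <-> subgradient A (2%:C *: W).
Proof.
move=> q1; have qn0 : q - 1 != 0 by rewrite subr_eq0 gt_eqF.
have := Sg_subgradient (W + (q - 1)%:C *: A) q1; set S := Sg _ _.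
have AE (X : 'M[C]_N) : (q - 1)^-1%:C *: ((q - 1)%:C *: X) = X.
  by rewrite scalerA -rmorphM mulVf // scale1r.
move=> hS; split=> [WS|hW].
  by move: hS; rewrite -WS addrAC subrr add0r AE.
apply/eqP; rewrite -subr_eq0; apply/eqP/sqnorm_eq0/eqP.
rewrite eq_le sqnorm_ge0 andbT.
have := subgradient_monotone hW hS.
have -> : A - (q - 1)^-1%:C *: (W + (q - 1)%:C *: A - S) =
          (- (q - 1)^-1)%:C *: (W - S).
  rewrite addrAC scalerDr AE opprD addrCA subrr addr0.
  by rewrite rmorphN scaleNr.
rewrite -scalerBr rdotZl rdotZr mulrCA mulNr.
rewrite oppr_ge0 pmulr_rle0 ?invr_gt0 ?subr_gt0 // pmulr_rle0 //.
Qed.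

End ConvexPart.

(** * Extension of subgradients from a subspace *)

Section HahnBanach.
Variables (R : realType) (m n : nat).
Local Notation C := R[i].
Local Notation V := 'M[C]_(m, n).
Implicit Types (p : V -> R) (G : V -> R -> Prop) (H : V -> Prop).

(** The graph of a real-linear functional on a subspace.  Working with graphs,
    whose functionality is never assumed, avoids choosing a decomposition of
    the vectors of an enlarged subspace. *)
Definition linear_graph G := G 0 0 /\
  forall x y r s (t : R), G x r -> G y s -> G (x + t%:C *: y) (r + t * s).

Definition dominated p G := forall x r, G x r -> r <= p x.

(** The admissible values l at v are bounded below by the quotients of L and
    above by their counterparts with the opposite sign of t; convexity of p at
    the point of the graph between x - a v and y + b v compares the two. *)
Lemma hahn_banach_step p G v : convex_on setT p -> linear_graph G ->
  dominated p G ->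
  exists l, forall x r (t : R), G x r -> r + t * l <= p (x + t%:C *: v).
Proof.
move=> pconv [G0 Glin] Gp.
have cross x r y s (a b : R) : G x r -> G y s -> 0 < a -> 0 < b ->
    a^-1 * (r - p (x - a%:C *: v)) <= b^-1 * (p (y + b%:C *: v) - s).
  move=> Gx Gy a0 b0; have ab0 : 0 < a + b by rewrite addr_gt0.
  rewrite ler_pdivrMl // mulrA [a * _]mulrC -mulrA ler_pdivlMl //.
  have Gz : G ((b / (a + b))%:C *: x + (a / (a + b))%:C *: y)
              (b / (a + b) * r + a / (a + b) * s).
    by apply: (Glin) Gy; have := Glin _ _ _ _ (b / (a + b)) G0 Gx; rewrite !add0r.
  have t01 : 0 <= b / (a + b) <= 1.
    by apply/andP; split; [rewrite divr_ge0 ?ltW|rewrite ler_pdivrMr // mul1r; lra].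
  have := pconv (x - a%:C *: v) (y + b%:C *: v) _ I I t01.
  have -> : 1 - b / (a + b) = a / (a + b) by field; rewrite gt_eqF.
  have -> : (b / (a + b))%:C *: (x - a%:C *: v) + (a / (a + b))%:C *: (y + b%:C *: v)
     = (b / (a + b))%:C *: x + (a / (a + b))%:C *: y.
    rewrite scalerBr scalerDr !scalerA -!rmorphM /= addrACA.
    have -> : b / (a + b) * a = a / (a + b) * b by ring.
    by rewrite addNr addr0.
  move=> /(le_trans (Gp _ _ Gz)).
  set P := p (x - _); set Q := p (y + _).
  have -> : b / (a + b) * r + a / (a + b) * s = (b * r + a * s) / (a + b).
    by field; rewrite gt_eqF.
  have -> : b / (a + b) * P + a / (a + b) * Q = (b * P + a * Q) / (a + b).
    by field; rewrite gt_eqF.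
  by rewrite ler_pM2r ?invr_gt0 //; lra.
pose L := [set l : R | exists x r (a : R),
  [/\ G x r, 0 < a & l = a^-1 * (r - p (x - a%:C *: v))]]%classic.
have L0 : (L !=set0)%classic.
  by exists (1^-1 * (0 - p (0 - 1%:C *: v))), 0, 0, 1; split.
exists (sup L) => x r t Gx.
have [t0|t0|->] := ltgtP t 0; last first.
- by rewrite mul0r scale0r !addr0; apply: Gp.
- suff : sup L <= t^-1 * (p (x + t%:C *: v) - r) by rewrite ler_pdivlMl //; lra.
  by apply: ge_sup => // _ [y [s [a [Gy a0 ->]]]]; apply: cross.
- have nt0 : 0 < - t by rewrite oppr_gt0.
  suff : (- t)^-1 * (r - p (x - (- t)%:C *: v)) <= sup L.
    by rewrite ler_pdivrMl // rmorphN scaleNr opprK; lra.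
  apply: ub_le_sup; last by exists x, r, (- t).
  exists (1^-1 * (p (0 + 1%:C *: v) - 0)) => _ [y [s [a [Gy a0 ->]]]].
  exact: cross.
Qed.

Lemma hahn_banach_seq p G (vs : seq V) : convex_on setT p -> linear_graph G ->
  dominated p G -> exists G', [/\ linear_graph G', dominated p G',
    forall x r, G x r -> G' x r & forall v, v \in vs -> exists l, G' v l].
Proof.
move=> pconv Glin Gp; elim: vs => [|v vs [G1 [[G10 G1lin] G1p GG1 G1vs]]].
  by exists G.
have [l vl] := hahn_banach_step v pconv (conj G10 G1lin) G1p.
pose G2 x r := exists y s (t : R), [/\ G1 y s, x = y + t%:C *: v & r = s + t * l].
have G12 x r : G1 x r -> G2 x r.
  by move=> Gx; exists x, r, 0; rewrite scale0r mul0r !addr0.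
exists G2; split=> [||x r /GG1/G12 //|u].
- split; first exact: G12.
  move=> _ _ _ _ t [x [r [a [Gx -> ->]]]] [y [s [b [Gy -> ->]]]].
  exists (x + t%:C *: y), (r + t * s), (a + t * b); split; first exact: G1lin.
    rewrite scalerDr scalerA addrACA; congr (_ + _).
    by rewrite -rmorphM -scalerDl -rmorphD.
  by ring.
- by move=> _ _ [y [s [t [Gy -> ->]]]]; apply: vl.
- rewrite in_cons => /orP[/eqP->|/G1vs[l' /G12]]; last by exists l'.
  by exists l, 0, 0, 1; rewrite scale1r mul1r !add0r.
Qed.

(** The graph of the functional B |-> rdot Z B on H, dominated by
    B |-> c (A + B) - c A, extends to a total graph; its values on the real
    basis delta_mx i j, 'i *: delta_mx i j are the real and imaginary parts of
    the entries of a full subgradient. *)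
Theorem subgradient_extension H c A Z :
  (forall x y (t : R), H x -> H y -> H (x + t%:C *: y)) -> H A ->
  convex_on setT c -> is_subgradient H c A Z ->
  exists2 Z', is_subgradient setT c A Z' & forall B, H B -> rdot Z' B = rdot Z B.
Proof.
move=> Hlin HA cconv [_ cZ].
have H0 : H 0 by have := Hlin A A (-1) HA HA; rewrite rmorphN scaleN1r subrr.
pose p B := c (A + B) - c A.
pose G B r := H B /\ r = rdot Z B.
have pconv : convex_on setT p.
  move=> x y t _ _ t01; have := cconv (A + x) (A + y) t I I t01.
  have -> : t%:C *: (A + x) + (1 - t)%:C *: (A + y) =
            A + (t%:C *: x + (1 - t)%:C *: y).
    by rewrite !scalerDr addrACA -scalerDl -rmorphD /= (addrC t) subrK scale1r.
  by rewrite /p; lra.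
have Glin : linear_graph G.
  split; first by split; rewrite // rdot0r.
  by move=> x y _ _ t [Hx ->] [Hy ->]; split; [apply: Hlin|rewrite !rdotr].
have Gp : dominated p G.
  move=> x _ [Hx ->]; have := cZ (A + x).
  rewrite addrAC subrr add0r /p => /(_ _); rewrite lerBrDl; apply.
  by have := Hlin A x 1 HA Hx; rewrite scale1r.
pose e (ij : 'I_m * 'I_n) : V := delta_mx ij.1 ij.2.
have [G' [[G'0 G'lin] G'p GG' G'e]] :=
  hahn_banach_seq ([seq e ij | ij <- enum predT] ++
                   [seq 'i *: e ij | ij <- enum predT]) pconv Glin Gp.
have /choice[r Gr] : forall ij, exists r, G' (e ij) r.
  move=> ij; apply: G'e.
  by rewrite mem_cat map_f // mem_enum.
have /choice[s Gs] : forall ij, exists s, G' ('i *: e ij) s.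
  move=> ij; apply: G'e.
  by rewrite mem_cat orbC (map_f (fun ij => 'i *: e ij)) // mem_enum.
pose Z' : V := \matrix_(i, j) (r (i, j) +i* s (i, j)).
have G'D x y a b : G' x a -> G' y b -> G' (x + y) (a + b).
  by move=> Gx Gy; have := G'lin _ _ _ _ 1 Gx Gy; rewrite scale1r mul1r.
have G'Z x a (t : R) : G' x a -> G' (t%:C *: x) (t * a).
  by move=> Gx; have := G'lin _ _ _ _ t G'0 Gx; rewrite !add0r.
have G'sum (I : finType) (F : I -> V) (a : I -> R) :
    (forall i, G' (F i) (a i)) -> G' (\sum_i F i) (\sum_i a i).
  by move=> Fa; apply: (big_ind2 G') => // *; apply: G'D.
have G'Z' B : G' B (rdot Z' B).
  rewrite rdotE {1}[B]matrix_sum_delta.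
  apply: (G'sum) => i; apply: (G'sum) => j.
  have -> : B i j *: delta_mx i j = (complex.Re (B i j))%:C *: e (i, j) +
     (complex.Im (B i j))%:C *: ('i *: e (i, j)).
    rewrite scalerA -scalerDl; congr (_ *: _).
    by rewrite [LHS]complexE [X in _ + X]mulrC.
  by rewrite mxE /= (mulrC (r _)) (mulrC (s _)); apply: G'D; apply: (G'Z).
exists Z'.
  by split=> // B _; have := G'p _ _ (G'Z' (B - A)); rewrite /p (addrC A) subrK; lra.
move=> B HB.
(* the difference d of two values of G' at B satisfies t * d <= p 0 = 0 for
   every real t *)
have dp t : t * (rdot Z' B - rdot Z B) <= 0.
  have GB := GG' _ _ (conj HB erefl); have := G'lin _ _ _ _ (-1) (G'Z' B) GB.
  rewrite rmorphN scaleN1r subrr mulN1r => /(G'Z _ _ t)/G'p.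
  by rewrite scaler0 /p addr0 subrr.
by apply/eqP; rewrite eq_le; move: (dp 1) (dp (-1)); lra.
Qed.

End HahnBanach.

(** * Orthogonal projections and uniqueness of gradients *)

Section Projection.
Variables (R : realType) (m n : nat).
Local Notation C := R[i].
Implicit Types (A B P : 'M[C]_(m, n)) (H : 'M[C]_(m, n) -> Prop).

Lemma dot_sym0 A B : dot A B = 0 -> dot B A = 0.
Proof. by rewrite (dotC A B) => ->; rewrite conjc0. Qed.

Lemma dot_eq0 A : dot A A = 0 -> A = 0.
Proof. by rewrite sqnorm_dot => /complexI/sqnorm_eq0. Qed.

Lemma oprojE H A P : (forall B D, H B -> H D -> H (B - D)) -> H P ->
  (forall B, H B -> dot (A - P) B = 0) -> oproj H A = P.
Proof.
move=> HB HP AP; rewrite /oproj; case: xgetP => [Q _ [HQ AQ]|/(_ P)[]//].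
apply/eqP; rewrite -subr_eq0; apply/eqP/dot_eq0.
rewrite {1}(_ : Q - P = (A - P) - (A - Q)); last by rewrite opprB [RHS]addrC addrA subrK.
by rewrite dotBl AP ?AQ ?subr0 //; apply: HB.
Qed.

(** Along a short step t D, with D the difference of the two gradients, both
    expansions hold up to e |t D|, so that |D| <= 2 e. *)
Lemma gradient_unique H (s : 'M[C]_(m, n) -> R) A Z1 Z2 :
  (forall B D (t : R), H B -> H D -> H (t%:C *: (B - D))) ->
  is_gradient H s A Z1 -> is_gradient H s A Z2 -> Z1 = Z2.
Proof.
move=> Hlin [H1 grad1] [H2 grad2]; apply/eqP; rewrite -subr_eq0; apply/eqP.
apply: sqnorm_eq0; rewrite -fnorm_sqr; set D := Z1 - Z2.
have [->|D0] := eqVneq (fnorm D) 0; first by rewrite expr0n.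
have {}D0 : 0 < fnorm D by rewrite lt_def D0 sqrtr_ge0.
have e0 : 0 < fnorm D / 4 by rewrite divr_gt0.
have [d1 d1_gt0 le1] := grad1 _ e0; have [d2 d2_gt0 le2] := grad2 _ e0.
(* a step along D short enough for both expansions *)
pose d := Num.min d1 d2; have d0 : 0 < d by rewrite lt_min d1_gt0.
pose t := d / (2 * fnorm D); have t0 : 0 < t by rewrite divr_gt0 ?mulr_gt0.
have HtD : H (t%:C *: D) by exact: Hlin.
have ntD : fnorm (t%:C *: D) = d / 2.
  by rewrite fnormZ ?ltW // /t; field; rewrite gt_eqF.
have dd : d / 2 < d by lra.
have := le1 _ HtD; have := le2 _ HtD; rewrite ntD.
have -> : d / 2 < d1 by rewrite (lt_le_trans dd) // ge_min lexx.
have -> : d / 2 < d2 by rewrite (lt_le_trans dd) // ge_min lexx orbT.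
move=> /(_ isT) + /(_ isT); rewrite !ler_norml => /andP[a1 a2] /andP[b1 b2].
have tD : rdot Z1 (t%:C *: D) - rdot Z2 (t%:C *: D) = d / 2 * fnorm D.
  rewrite -rdotNl -rdotDl -/D rdotZr -[rdot D D]/(sqnorm D) -fnorm_sqr /t.
  by field; rewrite gt_eqF.
have : 0 < fnorm D * d by rewrite mulr_gt0.
by lra.
Qed.

End Projection.

Section HankelProjection.
Variables (R : realType) (N : nat).
Local Notation C := R[i].
Local Notation M := (2 * N - 1)%N.
Implicit Types (A B : 'M[C]_N) (a v : 'cV[C]_M).

Lemma hankel_lin (c : C) A B : hankel A -> hankel B -> hankel (A + c *: B).
Proof. by move=> hA hB j k j' k' e; rewrite !mxE (hA _ _ _ _ e) (hB _ _ _ _ e). Qed.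

Lemma hankelZ (c : C) A : hankel A -> hankel (c *: A).
Proof. by move=> hA j k j' k' e; rewrite !mxE (hA _ _ _ _ e). Qed.

Lemma hankelB A B : hankel A -> hankel B -> hankel (A - B).
Proof. by move=> hA hB; rewrite -scaleN1r; apply: hankel_lin. Qed.

Lemma LambdaZ (c : C) a : Lambda (c *: a) = c *: Lambda a.
Proof. by apply/matrixP => j k; rewrite !mxE. Qed.

Lemma pmulD p (w : 'I_p -> R) (x y : 'cV[C]_p) :
  pmul w (x + y) = pmul w x + pmul w y.
Proof. by apply/colP => j; rewrite !mxE mulrDr. Qed.

Lemma pmulZ p (w : 'I_p -> R) (c : C) (x : 'cV[C]_p) :
  pmul w (c *: x) = c *: pmul w x.
Proof. by apply/colP => j; rewrite !mxE mulrCA. Qed.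

Lemma Lambda_invD A B : Lambda_inv (A + B) = Lambda_inv A + Lambda_inv B.
Proof.
rewrite -pmulD; congr pmul; apply/colP => l; rewrite !mxE -big_split /=.
by apply: eq_bigr => p _; rewrite mxE.
Qed.

Lemma dot_Lambda A v : dot A (Lambda v) = dot (Lambda_adj A) v.
Proof.
rewrite !dotE pair_bigA (partition_big (fun p => antidiag p.1 p.2) xpredT) //=.
apply: eq_bigr => l _; rewrite big_ord_recl big_ord0 addr0 !mxE mulr_suml.
by apply: eq_bigr => p /eqP <-; rewrite mxE.
Qed.

Lemma dot_pmul p (w : 'I_p -> R) (x y : 'cV[C]_p) :
  dot (pmul w x) y = dot x (pmul w y).
Proof.
rewrite !dotE; apply: eq_bigr => i _; apply: eq_bigr => j _.
by rewrite !ord1 !mxE rmorphM /= conjR mulrCA mulrA.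
Qed.

Lemma rdot_pmul p (w : 'I_p -> R) (x y : 'cV[C]_p) :
  rdot (pmul w x) y = rdot x (pmul w y).
Proof. by rewrite /rdot dot_pmul. Qed.

Lemma dot_mulmx_adj p (X : 'M[C]_(p, M)) (x : 'cV[C]_p) a :
  dot (X^t* *m x) a = dot x (X *m a).
Proof. by rewrite /dot trmxCM -mulmxA mxtrace_mulC mulmxA. Qed.

(** Lambda and Lambda_adj are adjoint, and Lambda_adj does not distinguish A from
    Lambda (Lambda_inv A), since Lambda_adj \o Lambda is multiplication by
    beta. *)
Lemma hankel_proj_orth A B : hankel B -> dot (A - Lambda (Lambda_inv A)) B = 0.
Proof.
move=> /Lambda_surj[b ->]; rewrite dotBl !dot_Lambda.
suff -> : Lambda_adj (Lambda (Lambda_inv A)) = Lambda_adj A by rewrite subrr.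
apply/colP => l; rewrite Lambda_adjE mxE mulrA -rmorphM /=.
by rewrite mulfV ?rmorph1 ?mul1r // gt_eqF ?beta_gt0.
Qed.

Lemma oproj_hankel A : oproj hankel A = Lambda (Lambda_inv A).
Proof.
apply: oprojE; [exact: hankelB | exact: Lambda_hankel | exact: hankel_proj_orth].
Qed.

Lemma rdot_oproj_hankel W B : hankel B -> rdot (oproj hankel W) B = rdot W B.
Proof.
move=> hB; apply/eqP; rewrite eq_sym -subr_eq0 -rdotNl -rdotDl oproj_hankel.
by rewrite /rdot hankel_proj_orth.
Qed.

Lemma oproj_perp_hankel A : oproj_perp hankel A = A - oproj hankel A.
Proof.
rewrite oproj_hankel; apply: oprojE => [B D HB HD X HX|B HB|B HB].
- by rewrite dotBl HB // HD // subrr.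
- exact: hankel_proj_orth.
- by rewrite subKr; apply: dot_sym0; apply: HB; apply: Lambda_hankel.
Qed.

End HankelProjection.

(** * The quadratic part of the objective and the fixed points *)

Section FixedPoints.
Variables (R : realType) (N J : nat).
Local Notation C := R[i].
Variables (IX : 'M[C]_(J, 2 * N - 1)) (mu : 'I_J -> R) (f : 'cV[C]_J) (tau q : R).
Implicit Types (A B W : 'M[C]_N).

Local Notation K := (samplop IX mu).
Local Notation obj := (objectiveH IX mu f tau).
Local Notation conv := (convex_part tau).

(** The adjoint of the sampling map A |-> IX *m Lambda_inv A. *)
Definition backproj (v : 'cV[C]_J) : 'M[C]_N :=
  Lambda (pmul (fun l => (beta R l)^-1) (IX^t* *m v)).

Lemma dot_backproj v B : dot (backproj v) B = dot v (IX *m Lambda_inv B).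
Proof.
by rewrite dotC dot_Lambda -dotC dot_pmul dot_mulmx_adj.
Qed.

Lemma rdot_backproj v B : rdot (backproj v) B = rdot v (IX *m Lambda_inv B).
Proof. by rewrite /rdot dot_backproj. Qed.

Lemma rdot_samplop A B :
  rdot (K A) B = rdot (pmul mu (IX *m Lambda_inv A)) (IX *m Lambda_inv B).
Proof. exact: rdot_backproj. Qed.

Lemma rdot_samplopC A B : rdot (K A) B = rdot (K B) A.
Proof. by rewrite [LHS]rdot_samplop [RHS]rdot_samplop rdot_pmul rdotC. Qed.

Lemma fidelityE a :
  fidelity IX mu f a = rdot (pmul mu (IX *m a - f)) (IX *m a - f).
Proof.
rewrite rdotE; apply: eq_bigr => j _; rewrite big_ord_recl big_ord0 addr0.
rewrite [pmul _ _ _ _]mxE; move: ((IX *m a - f) j 0) => z.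
have -> : complex.Re `|z| ^+ 2 = complex.Re z ^+ 2 + complex.Im z ^+ 2.
  by rewrite normc_def sqr_sqrtr // addr_ge0 ?sqr_ge0.
by case: z => x y /=; ring.
Qed.

(** Half of the negative gradient of the quadratic part of the objective, see
    quadratic_expansion; it is also the target of the Hankel part of W at a fixed
    point, see Bus_fixedP. *)
Definition descent A : 'M[C]_N := backproj (pmul mu f) + A - K A.

Lemma descent_hankel A : hankel A -> hankel (descent A).
Proof.
move=> hA; apply: hankelB; last exact: Lambda_hankel.
by rewrite -(scale1r A); apply: hankel_lin => //; apply: Lambda_hankel.
Qed.

Definition quadratic_part A : R := fidelity IX mu f (Lambda_inv A) - sqnorm A.

Lemma objectiveH_split A : hankel A -> obj A = conv A + quadratic_part A.
Proof.
by move=> hA; rewrite /quadratic_part -(objectiveH_sub IX mu f tau hA) addrC subrK.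
Qed.

Lemma quadratic_form_scale (c : R) A :
  rdot (K (c%:C *: A) - c%:C *: A) (c%:C *: A) = c ^+ 2 * rdot (K A - A) A.
Proof.
have KcA : rdot (K (c%:C *: A)) A = c * rdot (K A) A.
  exact: etrans (rdot_samplopC _ _) (rdotZr _ _ _).
move: (K A) (K _) KcA => X Y KcA.
by rewrite rdotZr 2!rdotDl 2!rdotNl KcA rdotZl; ring.
Qed.

(** The fidelity term contributes rdot (samplop IX mu B) B at second order, and
    the subtracted squared norm contributes - sqnorm B. *)
Lemma quadratic_expansion A B :
  quadratic_part (A + B) =
  quadratic_part A + rdot (- (2%:C *: descent A)) B + rdot (K B - B) B.
Proof.
rewrite /quadratic_part !fidelityE.
set E := IX *m Lambda_inv A - f; set L := IX *m Lambda_inv B.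
have -> : IX *m Lambda_inv (A + B) - f = E + L.
  by rewrite Lambda_invD mulmxDr addrAC.
rewrite pmulD.
have Lmu : rdot (pmul mu L) E = rdot (pmul mu E) L.
  by rewrite rdot_pmul rdotC.
have KBB : rdot (K B) B = rdot (pmul mu L) L by rewrite rdot_samplop.
have EL : rdot (pmul mu E) L = rdot (K A) B - rdot (backproj (pmul mu f)) B.
  rewrite [X in _ - X]rdot_backproj (rdot_samplop A) -/L -rdotNl -rdotDl.
  congr (rdot _ _); rewrite /E pmulD; congr (_ + _).
  by rewrite -scaleN1r pmulZ scaleN1r.
rewrite /descent; clearbody E L.
move: (K A) (K B) (backproj _) (pmul mu E) (pmul mu L) Lmu KBB EL.
move=> KA KB F muE muL Lmu KBB EL.
rewrite /sqnorm !(rdotDl, rdotNl, rdotDr, rdotZl) Lmu KBB (rdotC B A) EL.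
ring.
Qed.

Lemma Uop_descent A : 1 < q ->
  q%:C *: Uop IX mu q (Fdata IX mu f q) A = descent A + (q - 1)%:C *: A.
Proof.
move=> q1; have q0 : q != 0 by rewrite gt_eqF // (lt_trans _ q1).
have qK (X : 'M[C]_N) : q%:C *: (q^-1%:C *: X) = X.
  by rewrite scalerA -rmorphM mulfV // scale1r.
rewrite /Uop /Fdata -scalemxAr pmulZ LambdaZ.
have -> : Lambda (pmul (fun l => (q * beta R l)^-1) (IX^t* *m pmul mu
    (IX *m pmul (fun l => (beta R l)^-1) (Lambda_adj A)))) = q^-1%:C *: K A.
  rewrite /samplop -LambdaZ -pmulZ; congr Lambda; apply/colP => l; rewrite !mxE.
  by rewrite invfM rmorphM mulrCA mulrA.
rewrite /descent -[X in _ *: (_ *: X + _ - _)]/(backproj (pmul mu f)).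
move: (K A) (backproj _) => KA F.
rewrite scalerBr scalerDr !qK rmorphB scalerBl scale1r.
by rewrite addrAC -!addrA; congr (_ + _); rewrite addrCA [A + _]addrC subrK addrC.
Qed.

(** The first component of Bus thresholds the Hankel matrix
    descent A + (q - 1) A plus the non-Hankel part of W.  The second component is
    A exactly when the Hankel part of W is descent A, and then the matrix that is
    thresholded is W + (q - 1) A. *)
Lemma Bus_fixedP W A : 1 < q -> hankel A ->
  Bus IX mu f tau q (W, A) = (W, A) <->
  W = Sg (stq tau q) (W + (q - 1)%:C *: A) /\ oproj hankel W = descent A.
Proof.
move=> q1 hA; have q10 : q - 1 != 0 by rewrite subr_eq0 gt_eqF.
rewrite /Bus Uop_descent // oproj_perp_hankel.
set P := oproj hankel W; set D := descent A.
have AE (X : 'M[C]_N) : (q - 1)^-1%:C *: ((q - 1)%:C *: X) = X.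
  by rewrite scalerA -rmorphM mulVf // scale1r.
have WE : P = D -> D + (q - 1)%:C *: A + (W - P) = W + (q - 1)%:C *: A.
  by move=> ->; rewrite addrC addrA subrK.
split=> [[eW]|[WS PD]]; last first.
  by rewrite WE // -WS -/P PD addrAC subrr add0r AE.
rewrite eW -/P => eA; have PD : P = D.
  apply/eqP; rewrite eq_sym -subr_eq0.
  move: eA => /(congr1 (fun X => (q - 1)%:C *: X)).
  rewrite scalerA -rmorphM mulfV // scale1r => /eqP.
  by rewrite -subr_eq0 addrAC addrK.
by split=> //; rewrite -[LHS]eW WE.
Qed.

End FixedPoints.

(** * Stationary points and convexity of the objective *)

#[local] Opaque samplop objectiveH convex_part quadratic_part descent.

Section Stationarity.
Variables (R : realType) (N J : nat).
Local Notation C := R[i].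
Variables (IX : 'M[C]_(J, 2 * N - 1)) (mu : 'I_J -> R) (f : 'cV[C]_J) (tau q : R).
Implicit Types (A B W : 'M[C]_N).

Local Notation K := (samplop IX mu).
Local Notation obj := (objectiveH IX mu f tau).
Local Notation conv := (convex_part tau).
Local Notation desc := (descent IX mu f).

Lemma hankel_segment (t : R) A B : hankel A -> hankel B ->
  hankel (t%:C *: A + (1 - t)%:C *: B).
Proof. by move=> hA hB; apply: hankel_lin => //; apply: hankelZ. Qed.

Lemma samplop_le (S T : 'M[C]_N -> 'M[C]_N) A : op_le hankel S T -> hankel A ->
  rdot (S A) A <= rdot (T A) A.
Proof.
move=> ST hA; rewrite -subr_ge0 -rdotNl -rdotDl.
by have := ST _ hA; rewrite lecE => /andP[].
Qed.

(** The remainder rdot (samplop IX mu B - B) B lies between - |B|^2 and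
    (q - 1) |B|^2, by positivity of mu and the bound q on the sampling
    operator. *)
Lemma quadratic_gradient A :
  op_le hankel K (fun B => q%:C *: B) -> (forall j, 0 < mu j) -> 1 < q ->
  hankel A ->
  is_gradient hankel (fun B => obj B - conv B) A (- (2%:C *: desc A)).
Proof.
move=> Kq mu0 q1 hA; split.
  by rewrite -scaleNr; apply/hankelZ/descent_hankel.
move=> e e0; exists (e / q); first by rewrite divr_gt0 // (lt_trans _ q1).
move=> B hB nB; have hAB : hankel (A + B) by rewrite -(scale1r B); apply: hankel_lin.
have -> : obj (A + B) - conv (A + B) - (obj A - conv A) -
    rdot (- (2%:C *: desc A)) B = rdot (K B - B) B.
  rewrite (objectiveH_split _ _ _ _ hAB) (objectiveH_split _ _ _ _ hA).
  rewrite quadratic_expansion; move: (rdot _ _) (rdot _ _) => x y; ring.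
have KB := samplop_le Kq hB.
have K0 : 0 <= rdot (K B) B.
  rewrite rdot_samplop rdotE; apply: sumr_ge0 => i _; apply: sumr_ge0 => j _.
  rewrite ord1 mxE; case: (_ i 0) => x y /=; have := mu0 i.
  by have := sqr_ge0 x; have := sqr_ge0 y; nra.
have nB0 : 0 <= fnorm B by rewrite sqrtr_ge0.
rewrite rdotDl rdotNl -[rdot B B]/(sqnorm B) -fnorm_sqr.
move: KB; rewrite rdotZl -[rdot B B]/(sqnorm B) -fnorm_sqr.
move: nB; rewrite ltr_pdivlMr ?(lt_trans _ q1) // => nB KB.
have : fnorm B * (fnorm B * q) <= fnorm B * e by rewrite ler_wpM2l // ltW.
have : 0 <= (q - 1) * fnorm B ^+ 2 by rewrite mulr_ge0 ?sqr_ge0 // subr_ge0 ltW.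
by rewrite ler_norml; nra.
Qed.

Lemma stationaryP A :
  op_le hankel K (fun B => q%:C *: B) -> (forall j, 0 < mu j) -> 1 < q ->
  hankel A ->
  stationary hankel conv obj A <-> is_subgradient hankel conv A (2%:C *: desc A).
Proof.
move=> Kq mu0 q1 hA; have grad := quadratic_gradient Kq mu0 q1 hA.
split=> [[Z1 [Z2 [sub grad2 Z12]]]|sub].
  have Z2E : Z2 = - (2%:C *: desc A).
    apply: gradient_unique grad2 grad => B D t hB hD.
    by apply/hankelZ/hankelB.
  by move: Z12; rewrite Z2E => /eqP; rewrite subr_eq0 => /eqP <-.
by exists (2%:C *: desc A), (- (2%:C *: desc A)); split=> //; rewrite subrr.
Qed.

(** Subgradients of the restriction to the Hankel matrices are projections of
    subgradients on the whole space: one direction is the extension theorem, the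
    other holds because the projection does not change inner products with Hankel
    matrices. *)
Lemma subgradient_hankelP A Z : hankel A -> hankel Z ->
  is_subgradient hankel conv A (2%:C *: Z) <->
  exists2 W, is_subgradient setT conv A (2%:C *: W) & oproj hankel W = Z.
Proof.
move=> hA hZ; split=> [sub|[W [_ sub] <-]].
  have [|Z' sub' Z'Z] := subgradient_extension _ hA (@convex_part_convex _ _ tau) sub.
    by move=> B D t hB hD; apply: hankel_lin.
  have two (X : 'M[C]_N) : 2%:C *: (2^-1%:C *: X) = X.
    by rewrite scalerA -rmorphM mulfV ?scale1r // pnatr_eq0.
  exists (2^-1%:C *: Z'); first by rewrite two.
  apply/eqP; rewrite -subr_eq0; apply/eqP/sqnorm_eq0.
  set P := oproj _ _; have hP : hankel P.
    by rewrite /P oproj_hankel; apply: Lambda_hankel.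
  have hD : hankel (P - Z) by apply: hankelB.
  rewrite /sqnorm rdotDl rdotNl rdot_oproj_hankel // rdotZl Z'Z // rdotZl.
  by rewrite mulrA mulVf ?mul1r ?subrr // pnatr_eq0.
split; first by rewrite oproj_hankel; apply/hankelZ/Lambda_hankel.
move=> B hB; have := sub B I.
by rewrite !rdotZl rdot_oproj_hankel //; apply: hankelB.
Qed.

(** The convex part has a nonnegative convexity gap, and the gap of a quadratic
    function is t (1 - t) times its second order term at A - B. *)
Lemma objective_convexity_gap A B (t : R) : hankel A -> hankel B -> 0 <= t <= 1 ->
  obj (t%:C *: A + (1 - t)%:C *: B) + t * (1 - t) * rdot (K (A - B) - (A - B)) (A - B)
  <= t * obj A + (1 - t) * obj B.
Proof.
move=> hA hB t01; set D := t%:C *: A + _.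
have hD : hankel D by apply: hankel_segment.
set gap := rdot (K (A - B) - _) _; pose slope := rdot (- (2%:C *: desc D)) (A - B).
have quadr (c : R) : quadratic_part IX mu f (D + c%:C *: (A - B)) =
    quadratic_part IX mu f D + c * slope + c ^+ 2 * gap.
  by rewrite quadratic_expansion rdotZr quadratic_form_scale.
have := quadr (1 - t); have := quadr (- t).
rewrite -segment_left -segment_right.
have := objectiveH_split IX mu f tau hA; have := objectiveH_split IX mu f tau hB.
have := objectiveH_split IX mu f tau hD.
have := @convex_part_convex _ _ tau A B t I I t01; rewrite -/D.
clearbody slope gap.
move: (conv D) (conv A) (conv B) => cD cA cB.
move: (quadratic_part IX mu f D) (quadratic_part IX mu f A) => sD sA.
move: (quadratic_part IX mu f B) => sB cvx -> -> -> -> ->; lra.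
Qed.

End Stationarity.

Theorem corollary6p2 (R : realType) (N J : nat) (hN : (1 <= N)%N) (hJ : (1 <= J)%N)
  (IX : 'M[R[i]]_(J, 2 * N - 1)) (f : 'cV[R[i]]_J) (tau : R) (htau : 0 < tau)
  (mu : 'I_J -> R) (hmu : forall j, 0 < mu j) (q : R) (hq : 1 < q)
  (hqI : op_le hankel (samplop IX mu) (fun A : 'M[R[i]]_N => q%:C *: A)) :
  [/\ forall a0 : 'cV[R[i]]_(2 * N - 1),
        (exists W0 : 'M[R[i]]_N,
           Bus IX mu f tau q (W0, Lambda a0) = (W0, Lambda a0)) <->
        stationary hankel (convex_part tau) (objectiveH IX mu f tau) (Lambda a0),
      op_le hankel (fun A : 'M[R[i]]_N => A) (samplop IX mu) ->
        convex_on hankel (objectiveH IX mu f tau) &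
      op_lt hankel (fun A : 'M[R[i]]_N => A) (samplop IX mu) ->
        strictly_convex_on hankel (objectiveH IX mu f tau)].
Proof.
split=> [a0|IK A B t hA hB t01|IK A B t hA hB AB /andP[t0 t1]].
- have hA := Lambda_hankel a0; set A := Lambda a0 in hA *.
  rewrite (stationaryP f tau hqI hmu hq hA).
  rewrite (subgradient_hankelP tau hA (descent_hankel IX mu f hA)).
  split=> [[W /(Bus_fixedP _ _ _ _ _ hq hA)[]]|[W]].
    by move=> /(Sg_fixedP _ _ _ hq) ? ?; exists W.
  move=> sub WD; exists W; apply/(Bus_fixedP _ _ _ _ _ hq hA).
  by split=> //; apply/(Sg_fixedP _ _ _ hq).
- apply: le_trans (objective_convexity_gap IX mu f tau hA hB t01).
  have [t0 t1] := andP t01.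
  rewrite lerDl mulr_ge0 ?mulr_ge0 ?subr_ge0 // rdotDl rdotNl subr_ge0.
  exact: (samplop_le IK (hankelB hA hB)).
- have t01 : 0 <= t <= 1 by rewrite !ltW.
  apply: lt_le_trans (objective_convexity_gap IX mu f tau hA hB t01).
  rewrite ltrDl !mulr_gt0 ?subr_gt0 //.
  have := IK _ (hankelB hA hB); rewrite subr_eq0 => /(_ AB).
  by rewrite ltcE => /andP[].
Qed.
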